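(* Let $\{X_t\}_{t\ge 0}$ be an irreducible, positive recurrent discrete-time Markov chain on a countable state space $\mathbb{E}$ with transition matrix $P$ and invariant distribution $\boldsymbol{\pi}$, and let $\boldsymbol{g}$ be a real vector on $\mathbb{E}$ with $\boldsymbol{\pi}|\boldsymbol{g}|<\infty$. Partition $\mathbb{E}=A\cup B$ into two disjoint proper non-empty subsets, and partition accordingly $$P=\begin{bmatrix}P_A & P_{AB}\\ P_{BA} & P_B\end{bmatrix},\qquad \boldsymbol{h}=\begin{bmatrix}\boldsymbol{h}_A\\ \boldsymbol{h}_B\end{bmatrix}.$$ Let $N_B=\sum_{n=0}^\infty P_B^n$. Let $T(A)=\inf\{t\ge 1: X_t\in A\}$ and for $i\in\mathbb{E}$ let $y_i(A)={\rm E}[\sum_{0\le t<T(A)} g_{X_t}\mid X_0=i]$ and $\tau_i(A)={\rm E}[T(A)\mid X_0=i]$, with $\boldsymbol{y}_A(A),\boldsymbol{y}_B(A),\boldsymbol{\tau}_A(A),\boldsymbol{\tau}_B(A)$ the restrictions of these vectors to $A$ and $B$. Then the vector $\boldsymbol{h}$ given by $$\boldsymbol{h}_A=\boldsymbol{y}_A(A)-(\boldsymbol{\pi}\boldsymbol{g})\,\boldsymbol{\tau}_A(A)+(P_A+P_{AB}N_BP_{BA})\,\boldsymbol{h}_A$$ and $$\boldsymbol{h}_B=\boldsymbol{y}_B(A)-(\boldsymbol{\pi}\boldsymbol{g})\,\boldsymbol{\tau}_B(A)+N_BP_{BA}\,\boldsymbol{h}_A$$ is a solution of Poisson's equation $(I-P)\boldsymbol{h}=\boldsymbol{g}-\omega\boldsymbol{1}$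 with $\omega=\boldsymbol{\pi}\boldsymbol{g}$.
   Context: $\boldsymbol{1}$ denotes the all-ones column vector and $|\boldsymbol{g}|$ the componentwise absolute value of $\boldsymbol{g}$. *)

(* Defs.v *)
From HB Require Import structures.
From mathcomp Require Import all_boot all_order all_algebra.
From mathcomp Require Import all_classical all_reals all_analysis.
Set Implicit Arguments.
Unset Strict Implicit.
Unset Printing Implicit Defensive.
Import Order.TTheory GRing.Theory Num.Theory.
Local Open Scope classical_set_scope.
Local Open Scope ring_scope.

(* Sum over a (countable) set D of a real family, as positive part minus
   negative part (both nonnegative extended-real sums); this is the usual
   value of the sum when the family is absolutely summable. *)
Definition rsum {R : realType} {T : choiceType} (D : set T) (f : T -> R) : R :=
  fine (\esum_(x in D) (Num.max (f x) 0)%:E)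
  - fine (\esum_(x in D) (Num.max (- f x) 0)%:E).

Definition stochastic {R : realType} {E : choiceType} (P : E -> E -> R) : Prop :=
  (forall i j, 0 <= P i j) /\ (forall i, \esum_(j in [set: E]) (P i j)%:E = 1%E).

Definition markov_chain {R : realType} {E : choiceType} {d : measure_display}
    {Omega : measurableType d} (Pr : probability Omega R) (X : nat -> Omega -> E)
    (lam : E -> R) (P : E -> E -> R) : Prop :=
  (forall t (x : E), measurable (X t @^-1` [set x])) /\
  (forall n (x : nat -> E),
     Pr [set w | forall k, (k <= n)%N -> X k w = x k]
       = (lam (x 0%N) * \prod_(k < n) P (x k) (x k.+1))%:E).

(* T(A)(w) = inf {t >= 1 : X_t(w) \in A}  (= +oo if the set is empty) *)
Definition hit_time (R : realType) {E : Type} {Omega : Type}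
    (X : nat -> Omega -> E) (A : set E) (w : Omega) : \bar R :=
  ereal_inf [set ((t%:R)%:E : \bar R) | t in [set t : nat | (0 < t)%N /\ A (X t w)]].

Definition exc_sum {R : realType} {E : Type} {Omega : Type}
    (X : nat -> Omega -> E) (g : E -> R) (A : set E) (w : Omega) : \bar R :=
  (\sum_(0 <= t <oo)
      (if (t%:R%:E < hit_time R X A w)%E then g (X t w) else 0)%:E)%E.

(* y_i(A) = E[ sum_{0<=t<T(A)} g(X_t) | X_0 = i ]  (Pr i = law of the chain from i) *)
Definition yA {R : realType} {E : Type} {d : measure_display}
    {Omega : measurableType d} (Pr : E -> probability Omega R)
    (X : nat -> Omega -> E) (g : E -> R) (A : set E) (i : E) : R :=
  fine (\int[Pr i]_w exc_sum X g A w).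

Definition tauA {R : realType} {E : Type} {d : measure_display}
    {Omega : measurableType d} (Pr : E -> probability Omega R)
    (X : nat -> Omega -> E) (A : set E) (i : E) : R :=
  fine (\int[Pr i]_w hit_time R X A w).

Definition irreducible {R : realType} {E : Type} {d : measure_display}
    {Omega : measurableType d} (Pr : E -> probability Omega R)
    (X : nat -> Omega -> E) : Prop :=
  forall i j, (0 < Pr i [set w | exists n, X n w = j])%E.

Definition positive_recurrent {R : realType} {E : Type} {d : measure_display}
    {Omega : measurableType d} (Pr : E -> probability Omega R)
    (X : nat -> Omega -> E) : Prop :=
  forall i, Pr i [set w | (hit_time R X [set i] w < +oo)%E] = 1%E /\
            (\int[Pr i]_w hit_time R X [set i] w < +oo)%E.

Definition invariant_distribution {R : realType} {E : choiceType}
    (pi : E -> R) (P : E -> E -> R) : Prop :=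
  [/\ forall i, 0 <= pi i,
      \esum_(i in [set: E]) (pi i)%:E = 1%E &
      forall j, \esum_(i in [set: E]) (pi i * P i j)%:E = (pi j)%:E].

(* entries of P_B^n (indices in B) *)
Fixpoint PBpow {R : realType} {E : choiceType} (P : E -> E -> R) (B : set E)
    (n : nat) (k l : E) : \bar R :=
  if n is m.+1 then \esum_(j in B) (PBpow P B m k j * (P j l)%:E)%E
  else ((k == l)%:R)%:E.

Definition NB {R : realType} {E : choiceType} (P : E -> E -> R) (B : set E)
    (k l : E) : \bar R :=
  \esum_(n in [set: nat]) PBpow P B n k l.

(* entries of P_A + P_AB N_B P_BA (indices i, j in A) *)
Definition Qmat {R : realType} {E : choiceType} (P : E -> E -> R) (B : set E)
    (i j : E) : \bar R :=
  ((P i j)%:E + \esum_(k in B) \esum_(l in B) ((P i k)%:E * NB P B k l * (P l j)%:E))%E.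

(* entries of N_B P_BA (k in B, j in A) *)
Definition NBPBA {R : realType} {E : choiceType} (P : E -> E -> R) (B : set E)
    (k j : E) : \bar R :=
  \esum_(l in B) (NB P B k l * (P l j)%:E)%E.

(* Main.v *)
(* Let [K f i := sum_(k in B) P i k f k] act on nonnegative extended-real functions
   and let [G f := sum_n K^n f]; then [G f = f + K (G f)]. Summing over trajectories,
   [E_i (f (X_t); t < T(A)) = K^t f i], so [y = G g] and [tau = G 1], while
   [(P_A + P_AB N_B P_BA) f] and [N_B P_BA f] are the two blocks of [G (P_{.A} f)].
   Hence [h = G (g - w + P_{.A} h_A)], and [G = id + K G] is Poisson's equation.
   Splitting into positive and negative parts makes this rigorous once [G |g|] and
   [G 1] are finite. Invariance gives [pi f = pi_A f_A + pi (K f)], so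
   [pi_A (G f)_A <= pi f], whence finiteness on [A]; since [G f i >= P i k G f k] for
   [k] in [B], finiteness propagates along transitions, hence to all of [E] by
   irreducibility. *)
Require Import Defs.
From HB Require Import structures.
From mathcomp Require Import all_boot all_order all_algebra.
From mathcomp Require Import all_classical all_reals all_analysis.
From mathcomp Require Import measurable_realfun ring.
Set Implicit Arguments.
Unset Strict Implicit.
Unset Printing Implicit Defensive.
Import Order.TTheory GRing.Theory Num.Theory.
Local Open Scope classical_set_scope.
Local Open Scope ring_scope.

(** * Nonnegative extended-real sums: scaling, exchange and splitting *)

Section esum_extra.
Variables (R : realType).
Local Open Scope ereal_scope.

Lemma esum_term_le (T : choiceType) (D : set T) (a : T -> \bar R) x :
  (forall i, D i -> 0 <= a i) -> D x -> a x <= \esum_(i in D) a i.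
Proof.
move=> a0 Dx; apply: esum_ge; exists [set x]; last by rewrite fsbig_set1.
by split => // _ ->.
Qed.

Lemma esum_supported (T : choiceType) (D : set T) (a : T -> \bar R) x :
  (forall i, D i -> i <> x -> a i = 0) -> D x -> 0 <= a x ->
  \esum_(i in D) a i = a x.
Proof.
move=> a0 Dx ax; rewrite (esumID [set x]) => [|i Di]; last first.
  by have [->//|/eqP ix] := eqVneq i x; rewrite a0.
rewrite (_ : D `&` [set x] = [set x]); last first.
  by apply/seteqP; split => [y []|y ->].
by rewrite esum_set1// esum1 ?adde0// => i [Di /= ix]; exact: a0.
Qed.

(** Finite [c] commutes with the supremum over finite partial sums. For [c = +oo], one positive term
    makes both sides infinite, and if there is none both sides vanish. *)
Lemma esumZl (T : choiceType) (D : set T) (c : \bar R) (a : T -> \bar R) :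
  0 <= c -> (forall i, D i -> 0 <= a i) ->
  \esum_(i in D) (c * a i) = c * \esum_(i in D) a i.
Proof.
(* [b] extends [a] by zero off [D]: distributing over a finite sum asks for nonnegativity at every
   index. *)
move=> c0 a0; pose b i := if i \in D then a i else 0.
have b0 i : 0 <= b i by rewrite /b; case: ifPn => // /set_mem/a0.
have [b_eq0|[x Dx]] : (forall i, D i -> a i = 0) \/ (exists2 i, D i & 0 < a i).
- have [[x Dx ax]|nex] := pselect (exists2 i, D i & 0 < a i); first by right; exists x.
  left=> i Di; apply/eqP; rewrite eq_le a0// andbT leNgt.
  by apply/negP => ai; apply: nex; exists i.
- by rewrite !esum1 ?mule0// => i Di; rewrite b_eq0// mule0.
move=> ax; case: c c0 => [c| |]//; last first.
  move=> _; rewrite [RHS]gt0_mulye; last first.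
    by apply: lt_le_trans ax _; exact: esum_term_le.
  apply/eqP; rewrite -leye_eq -[X in X <= _](gt0_mulye ax).
  by apply: (@esum_term_le _ D (fun i => +oo * a i)) => // i Di; rewrite mule_ge0 ?a0.
rewrite lee_fin => c0.
rewrite /esum -ereal_supZl//; last first.
  by apply/set0P; eexists; exists set0; [exact: fsets_set0|reflexivity].
congr ereal_sup; apply/seteqP; split => [_ [X [fX XD]] <-|_ [_ [X [fX XD]] <-] <-].
- exists (\sum_(i \in X) a i); first by exists X.
  rewrite (eq_fsbigr b) => [|i /set_mem Xi]; last by rewrite /b mem_set//; exact: XD.
  rewrite ge0_mule_fsumr//; apply: eq_fsbigr => i /set_mem Xi.
  by rewrite /b mem_set//; exact: XD.
- exists X => //.
  rewrite [in RHS](eq_fsbigr b) => [|i /set_mem Xi]; last by rewrite /b mem_set//; exact: XD.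
  rewrite ge0_mule_fsumr//; apply: eq_fsbigr => i /set_mem Xi.
  by rewrite /b mem_set//; exact: XD.
Qed.

Lemma esumZr (T : choiceType) (D : set T) (c : \bar R) (a : T -> \bar R) :
  0 <= c -> (forall i, D i -> 0 <= a i) ->
  \esum_(i in D) (a i * c) = (\esum_(i in D) a i) * c.
Proof.
by move=> c0 a0; rewrite muleC -esumZl//; apply: eq_esum => i _; rewrite muleC.
Qed.

Lemma exchange_esum (T1 T2 : choiceType) (I : set T1) (J : set T2)
    (a : T1 -> T2 -> \bar R) :
  (forall i j, I i -> J j -> 0 <= a i j) ->
  \esum_(i in I) \esum_(j in J) a i j = \esum_(j in J) \esum_(i in I) a i j.
Proof.
move=> a0; rewrite !esum_esum//; last by move=> i j Ji Ij; exact: a0.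
apply: (@reindex_esum _ _ _ (J `*`` fun=> I) (I `*`` fun=> J) (fun p => (p.2, p.1))).
by split => [[x y] []//|[x y] [x' y'] _ _ [-> ->]//|[x y] [/= Ix Jy]]; exists (y, x).
Qed.

Lemma esum_nat_recl (a : nat -> \bar R) : (forall n, 0 <= a n) ->
  \esum_(n in [set: nat]) a n = a 0%N + \esum_(n in [set: nat]) a n.+1.
Proof.
move=> a0; rewrite (esumID [set 0%N])// setTI esum_set1//; congr (_ + _).
rewrite setTI; apply: reindex_esum; split => [n _//|m n _ _ [->]//|[|n]/=]; first by move/(_ erefl).
by move=> _; exists n.
Qed.

Lemma esum_nat_le (a : nat -> \bar R) (M : \bar R) : (forall n, 0 <= a n) ->
  (forall n, \sum_(k < n) a k <= M) -> \esum_(n in [set: nat]) a n <= M.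
Proof.
move=> a0 aM; rewrite -nneseries_esumT//; apply: lime_le.
  by apply: is_cvg_nneseries => n _ _; exact: a0.
by apply: nearW => n; rewrite big_mkord.
Qed.

End esum_extra.

(** * Real sums as differences of nonnegative sums *)

Section rsum.
Variables (R : realType) (T : choiceType).
Local Open Scope ereal_scope.

(** The value of [rsum] does not depend on how [f] is split into summable nonnegative parts: sum the
    pointwise identity [f^+ + q = p + f^-], where all four sums are finite. *)
Lemma rsum_sub (D : set T) (f p q : T -> R) :
  (forall x, D x -> (0 <= p x)%R) -> (forall x, D x -> (0 <= q x)%R) ->
  (forall x, D x -> f x = (p x - q x)%R) ->
  \esum_(x in D) (p x)%:E < +oo -> \esum_(x in D) (q x)%:E < +oo ->
  rsum D f = (fine (\esum_(x in D) (p x)%:E) - fine (\esum_(x in D) (q x)%:E))%R.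
Proof.
move=> p0 q0 fpq sp sq.
have spos : \esum_(x in D) (Num.max (f x) 0)%:E < +oo.
  apply: le_lt_trans sp; apply: le_esum => x Dx.
  by rewrite lee_fin fpq// ge_max p0// lerBlDr lerDl q0.
have sneg : \esum_(x in D) (Num.max (- f x) 0)%:E < +oo.
  apply: le_lt_trans sq; apply: le_esum => x Dx.
  by rewrite lee_fin fpq// ge_max q0// opprB lerBlDr lerDl p0.
have fin (a : T -> R) : (forall x, D x -> (0 <= a x)%R) -> \esum_(x in D) (a x)%:E < +oo ->
    \esum_(x in D) (a x)%:E \is a fin_num.
  by move=> a0 sa; rewrite ge0_fin_numE//; apply: esum_ge0 => x Dx; rewrite lee_fin a0.
have max0 (a : T -> R) x : D x -> (0 <= Num.max (a x) 0 :> R)%R by rewrite le_max lexx orbT.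
have fP := fin _ (max0 f) spos.
have fN := fin _ (max0 (fun x => - f x)%R) sneg.
have fp := fin _ p0 sp; have fq := fin _ q0 sq.
apply/eqP; rewrite /rsum subr_eq addrAC eq_sym subr_eq eq_sym -!fineD//.
rewrite -!esumD; try by move=> x Dx; rewrite lee_fin ?p0 ?q0 ?(max0 f) ?(max0 (fun x => - f x)%R).
apply/eqP; congr fine; apply: eq_esum => x Dx.
rewrite -!EFinD; congr EFin; rewrite fpq//.
have [pq|/ltW pq] := leP (p x) (q x).
  rewrite max_r ?subr_le0// add0r max_l ?oppr_ge0 ?subr_le0//.
  by rewrite opprB addrC subrK.
by rewrite max_l ?subr_ge0// subrK max_r ?addr0// oppr_le0 subr_ge0.
Qed.

(** Replacing an infinite weight by [fine +oo = 0] is harmless: summability forces [h x = 0]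
    wherever [q x = +oo], so that term vanishes under either reading. *)
Lemma rsum_fineM (D : set T) (q : T -> \bar R) (h : T -> R) :
  (forall x, 0 <= q x) -> \esum_(x in D) (q x * `|h x|%:E) < +oo ->
  rsum D (fun x => fine (q x) * h x)%R =
  (fine (\esum_(x in D) (q x * (Num.max (h x) 0)%R%:E))%E -
   fine (\esum_(x in D) (q x * (Num.max (- h x) 0)%R%:E))%E)%R.
Proof.
move=> q0 qh.
have qhx x : D x -> q x * `|h x|%:E < +oo.
  move=> Dx; apply: le_lt_trans qh.
  by apply: (@esum_term_le _ _ _ (fun x => q x * `|h x|%:E)) => // y _; rewrite mule_ge0.
have maxM (c : \bar R) (y : R) : 0 <= c -> c * `|y|%:E < +oo ->
    (Num.max (fine c * y) 0)%:E = c * (Num.max y 0)%:E.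
  case: c => [c| |]//=; first by rewrite lee_fin => c0 _; rewrite -EFinM maxr_pMr// mulr0.
  move=> _; have [->|y0] := eqVneq y 0%R; first by rewrite maxxx mulr0 maxxx mule0.
  by rewrite gt0_mulye ?lte_fin ?normr_gt0// ltxx.
rewrite /rsum; congr (fine _ - fine _)%R; apply: eq_esum => x Dx.
  by rewrite maxM// qhx.
by rewrite -mulrN maxM// normrN qhx.
Qed.

End rsum.

(** * The operators [K] and [G], and the matrices built from [N_B] *)

Section taboo.
Variables (R : realType) (E : choiceType) (P : E -> E -> R) (B : set E).
Hypothesis P0 : forall i j, 0 <= P i j.
Local Open Scope ereal_scope.
Implicit Types f g : E -> \bar R.

(** This is [K]. Its rows range over all of [E], so that it holds both [P_B] and [P_AB]. *)
Definition taboo f (i : E) : \bar R := \esum_(k in B) ((P i k)%:E * f k).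

(* This is [N_B f] on [B] and [f + P_AB N_B f] on the complement of [B]. *)
Definition potential f (i : E) : \bar R :=
  \esum_(n in [set: nat]) iter n taboo f i.

Lemma PE_ge0 i j : 0 <= (P i j)%:E. Proof. by rewrite lee_fin. Qed.
Hint Resolve PE_ge0 : core.

Lemma taboo_ge0 f i : (forall j, 0 <= f j) -> 0 <= taboo f i.
Proof. by move=> f0; apply: esum_ge0 => k _; exact: mule_ge0. Qed.

Lemma iter_taboo_ge0 f n i : (forall j, 0 <= f j) -> 0 <= iter n taboo f i.
Proof. by move=> f0; elim: n i => //= n ih i; exact: taboo_ge0. Qed.

Lemma potential_ge0 f i : (forall j, 0 <= f j) -> 0 <= potential f i.
Proof. by move=> f0; apply: esum_ge0 => n _; exact: iter_taboo_ge0. Qed.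

(** Split off the term [n = 0]; every other term has an outer [K], which Tonelli pulls out of the
    sum over [n]. *)
Lemma potentialE f i : (forall j, 0 <= f j) ->
  potential f i = f i + taboo (potential f) i.
Proof.
move=> f0; rewrite /potential esum_nat_recl => [|n]; last exact: iter_taboo_ge0.
congr (_ + _); rewrite /= /taboo exchange_esum => [|n k _ _]; last first.
  by apply: mule_ge0 => //; exact: iter_taboo_ge0.
by apply: eq_esum => k _; rewrite esumZl// => n _; exact: iter_taboo_ge0.
Qed.

Lemma tabooD f g i : (forall j, 0 <= f j) -> (forall j, 0 <= g j) ->
  taboo (fun j => f j + g j) i = taboo f i + taboo g i.
Proof.
move=> f0 g0; rewrite /taboo -esumD; try by move=> k _; exact: mule_ge0.
by apply: eq_esum => k _; rewrite ge0_muleDr.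
Qed.

Lemma potentialD f g i : (forall j, 0 <= f j) -> (forall j, 0 <= g j) ->
  potential (fun j => f j + g j) i = potential f i + potential g i.
Proof.
move=> f0 g0; rewrite /potential -esumD; try by move=> n _; exact: iter_taboo_ge0.
apply: eq_esum => n _; elim: n i => //= n ih i.
rewrite -tabooD; try by move=> j; exact: iter_taboo_ge0.
by congr taboo; apply/funext.
Qed.

Lemma potentialZ (c : R) f i : (0 <= c)%R -> (forall j, 0 <= f j) ->
  potential (fun j => c%:E * f j) i = c%:E * potential f i.
Proof.
move=> c0 f0; rewrite /potential -esumZl ?lee_fin//; last first.
  by move=> n _; exact: iter_taboo_ge0.
apply: eq_esum => n _; elim: n i => //= n ih i.
rewrite /taboo -esumZl ?lee_fin//; last first.
  by move=> k _; apply: mule_ge0 => //; exact: iter_taboo_ge0.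
by apply: eq_esum => k _; rewrite ih muleCA.
Qed.

Lemma le_potential f g i : (forall j, 0 <= f j) -> (forall j, f j <= g j) ->
  potential f i <= potential g i.
Proof.
move=> f0 fg; apply: le_esum => n _; elim: n i => //= n ih i.
by apply: le_esum => k _; rewrite lee_wpmul2l.
Qed.

Lemma PBpow_ge0 n k l : 0 <= PBpow P B n k l.
Proof.
elim: n l => [|n ih] l /=; first by rewrite lee_fin.
by apply: esum_ge0 => j _; rewrite mule_ge0.
Qed.

Lemma NB_ge0 k l : 0 <= NB P B k l.
Proof. by apply: esum_ge0 => n _; exact: PBpow_ge0. Qed.

(** [PBpow] grows by a factor on the right, next to [f]. The induction therefore generalises [f] and
    is used at [taboo f]. *)
Lemma PBpow_iter_taboo f n k : (forall j, 0 <= f j) -> B k ->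
  \esum_(l in B) (PBpow P B n k l * f l) = iter n taboo f k.
Proof.
move=> f0 Bk; elim: n f f0 => [|n ih] f f0 /=.
  rewrite (@esum_supported _ _ _ _ k)//= ?eqxx ?mul1e//.
  by move=> i _ ik; rewrite (_ : k == i = false) ?mul0e//; apply/eqP => ki; exact: ik.
under eq_esum => l _.
  rewrite -esumZr//; last by move=> j _; rewrite mule_ge0// PBpow_ge0.
  over.
rewrite /= exchange_esum => [|l j _ _]; last by rewrite !mule_ge0// PBpow_ge0.
rewrite -iterS iterSr -ih; last by move=> j; exact: taboo_ge0.
apply: eq_esum => j _; rewrite /taboo -esumZl ?PBpow_ge0// => [|l _]; last by rewrite mule_ge0.
by apply: eq_esum => l _; rewrite muleA.
Qed.

Lemma NB_potential f k : (forall j, 0 <= f j) -> B k ->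
  \esum_(l in B) (NB P B k l * f l) = potential f k.
Proof.
move=> f0 Bk; under eq_esum => l _.
  rewrite -esumZr//; last by move=> n _; exact: PBpow_ge0.
  over.
rewrite /= exchange_esum => [|l n _ _]; last by rewrite mule_ge0// PBpow_ge0.
by apply: eq_esum => n _; exact: PBpow_iter_taboo.
Qed.

(** The column block [P_{.A}]: the step that enters [A], from any row of [E]. *)
Definition restrictP (A : set E) f (i : E) : \bar R :=
  \esum_(j in A) ((P i j)%:E * f j).

Lemma restrictP_ge0 A f i : (forall j, 0 <= f j) -> 0 <= restrictP A f i.
Proof. by move=> f0; apply: esum_ge0 => k _; exact: mule_ge0. Qed.

Lemma NBPBA_ge0 k j : 0 <= NBPBA P B k j.
Proof. by apply: esum_ge0 => l _; rewrite mule_ge0// NB_ge0. Qed.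

Lemma QmatE i j : Qmat P B i j = (P i j)%:E + taboo (NBPBA P B ^~ j) i.
Proof.
congr (_ + _); apply: eq_esum => k _.
rewrite /NBPBA -esumZl// => [|l _]; last by rewrite mule_ge0// NB_ge0.
by apply: eq_esum => l _; rewrite muleA.
Qed.

Lemma Qmat_ge0 i j : 0 <= Qmat P B i j.
Proof. by rewrite QmatE adde_ge0// taboo_ge0// => k; exact: NBPBA_ge0. Qed.

Lemma NBPBA_potential A f k : (forall j, 0 <= f j) -> B k ->
  \esum_(j in A) (NBPBA P B k j * f j) = potential (restrictP A f) k.
Proof.
move=> f0 Bk; rewrite -NB_potential//; last by move=> j; exact: restrictP_ge0.
under eq_esum => j _.
  rewrite -esumZr//; last by move=> l _; rewrite mule_ge0// NB_ge0.
  over.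
rewrite /= exchange_esum => [|l n _ _]; last by rewrite !mule_ge0// NB_ge0.
apply: eq_esum => l _; rewrite -esumZl ?NB_ge0// => [|j _]; last by rewrite mule_ge0.
by apply: eq_esum => j _; rewrite muleA.
Qed.

(** By [QmatE] the left side is [P_{.A} f] plus [K] applied to [N_B P_BA f]. On [B] the latter is
    the potential of [P_{.A} f], so [potentialE] closes the identity. *)
Lemma Qmat_potential A f i : (forall j, 0 <= f j) ->
  \esum_(j in A) (Qmat P B i j * f j) = potential (restrictP A f) i.
Proof.
move=> f0; rewrite potentialE; last by move=> j; exact: restrictP_ge0.
under eq_esum => j _.
  rewrite QmatE ge0_muleDl//; last by apply: taboo_ge0 => k; exact: NBPBA_ge0.
  over.
rewrite esumD; first last.
- by move=> j _; rewrite mule_ge0// taboo_ge0// => k; exact: NBPBA_ge0.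
- by move=> j _; rewrite mule_ge0.
congr (_ + _); under eq_esum => j _.
  rewrite -esumZr//; last by move=> l _; rewrite mule_ge0// NBPBA_ge0.
  over.
rewrite /= exchange_esum => [|l n _ _]; last by rewrite !mule_ge0// NBPBA_ge0.
apply: eq_esum => k Bk; rewrite -NBPBA_potential// -esumZl// => [|j _]; last first.
  by rewrite mule_ge0// NBPBA_ge0.
by apply: eq_esum => j _; rewrite muleA.
Qed.

End taboo.

(** * Integration against the invariant distribution *)

Section invariant.
Variables (R : realType) (E : choiceType) (P : E -> E -> R) (pi : E -> R).
Variables (A B : set E).
Hypothesis P0 : forall i j, 0 <= P i j.
Hypothesis invpi : invariant_distribution pi P.
Hypothesis AB0 : A `&` B = set0.
Hypothesis ABT : A `|` B = [set: E].
Local Open Scope ereal_scope.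

Lemma esum_partition (f : E -> \bar R) : (forall j, 0 <= f j) ->
  \esum_(i in [set: E]) f i = \esum_(i in A) f i + \esum_(i in B) f i.
Proof.
move=> f0; rewrite (esumID A)// !setTI; congr (_ + esum _ _).
apply/seteqP; split => x.
  by move=> nA; have [] : (A `|` B) x by rewrite ABT.
by move=> Bx Ax; have ABx : (A `&` B) x by []; rewrite AB0 in ABx.
Qed.

Lemma pi_ge0 i : 0 <= (pi i)%:E.
Proof. by rewrite lee_fin; case: invpi. Qed.
Hint Resolve pi_ge0 : core.

(** In the sum over [B], each [pi k] is expanded as the sum of [pi i * P i k] over [i], and the sums
    are exchanged. *)
Lemma invariant_taboo (f : E -> \bar R) : (forall j, 0 <= f j) ->
  \esum_(i in [set: E]) ((pi i)%:E * f i) =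
  \esum_(i in A) ((pi i)%:E * f i) +
  \esum_(i in [set: E]) ((pi i)%:E * taboo P B f i).
Proof.
move=> f0; rewrite esum_partition => [|j]; last exact: mule_ge0.
congr (_ + _); under [RHS]eq_esum => i _.
  rewrite -esumZl//; last by move=> k _; rewrite mule_ge0// PE_ge0.
  over.
rewrite /= exchange_esum => [|i k _ _]; last by rewrite !mule_ge0// PE_ge0.
apply: eq_esum => k _; have [_ _ piP] := invpi.
rewrite -(piP k) -esumZr// => [|i _]; last by rewrite EFinM mule_ge0// PE_ge0.
by apply: eq_esum => i _; rewrite EFinM muleA.
Qed.

(** Using [invariant_taboo] [n] times writes [pi f] as the first [n] terms of the left side plus the
    nonnegative remainder [pi (K^n f)], so every partial sum is bounded by [pi f]. *)
Lemma invariant_potential (f : E -> \bar R) : (forall j, 0 <= f j) ->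
  \esum_(i in A) ((pi i)%:E * potential P B f i) <=
  \esum_(i in [set: E]) ((pi i)%:E * f i).
Proof.
move=> f0.
have Kf0 n i : 0 <= iter n (taboo P B) f i by exact: iter_taboo_ge0.
under eq_esum => i _.
  rewrite -esumZl//.
  over.
rewrite /= exchange_esum => [|i n _ _]; last exact: mule_ge0.
apply: esum_nat_le => [n|n]; first by apply: esum_ge0 => i _; exact: mule_ge0.
suff -> : \esum_(i in [set: E]) ((pi i)%:E * f i) =
    \sum_(k < n) \esum_(i in A) ((pi i)%:E * iter k (taboo P B) f i) +
    \esum_(i in [set: E]) ((pi i)%:E * iter n (taboo P B) f i).
  by rewrite leeDl//; apply: esum_ge0 => i _; exact: mule_ge0.
elim: n => [|n ih]; first by rewrite big_ord0 add0e.
by rewrite ih (invariant_taboo (Kf0 n)) big_ord_recr /= addeA.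
Qed.

End invariant.

(** * Functions of a map with countably many values *)

Section countable_valued.
Variables (R : realType) (d : measure_display) (Omega : measurableType d).
Local Open Scope ereal_scope.

Lemma esum_supported_image (T T' : choiceType) (D : set T) (e : T -> T')
    (a : T' -> \bar R) : set_inj D e -> (forall y, 0 <= a y) ->
  (forall y, ~ (e @` D) y -> a y = 0) ->
  \esum_(y in [set: T']) a y = \esum_(x in D) a (e x).
Proof.
move=> einj a0 aD; rewrite (esumID (e @` D))// !setTI [X in _ + X]esum1//.
by rewrite adde0 esum_image.
Qed.

Lemma measurable_fun_countable (T : countType) (Y : Omega -> T)
    (f : T -> \bar R) :
  (forall x, measurable (Y @^-1` [set x])) -> measurable_fun setT (f \o Y).
Proof.
move=> mY _ V _; rewrite setTI.
rewrite (_ : _ @^-1` V = \bigcup_(x in [set: T]) (Y @^-1` [set x] `&` [set _ | V (f x)])).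
  apply: countable_bigcupT_measurable => // x; apply: measurableI => //.
  have [Vx|nVx] := pselect (V (f x)).
    by rewrite (_ : [set _ | _] = setT)//; apply/seteqP; split.
  by rewrite (_ : [set _ | _] = set0)//; apply/seteqP; split.
by apply/seteqP; split => [w Vw|w [x _ [/= <-]]]; [exists (Y w)|].
Qed.

(** The fibres of [Y] are numbered by [pickle] so that countable additivity over [nat] applies; a
    number that codes no point has an empty fibre and contributes 0. *)
Lemma integral_countable (mu : {measure set Omega -> \bar R}) (T : countType)
    (Y : Omega -> T) (f : T -> \bar R) :
  (forall x, measurable (Y @^-1` [set x])) -> (forall x, 0 <= f x) ->
  \int[mu]_w f (Y w) = \esum_(x in [set: T]) (f x * mu (Y @^-1` [set x])).
Proof.
move=> mY f0; pose F n := [set w | pickle (Y w) = n].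
have Fpickle x : F (pickle x) = Y @^-1` [set x].
  by apply/seteqP; split => w; [move/(pcan_inj pickleK)|move=> <-].
have Fnone n : ~ range (@pickle T) n -> F n = set0.
  by move=> nn; apply/seteqP; split => // w Fw; apply: nn; exists (Y w).
have mF n : measurable (F n).
  have [[x _ <-]|/Fnone ->//] := pselect (range (@pickle T) n).
  by rewrite Fpickle.
have FT : \bigcup_n F n = setT.
  by apply/seteqP; split => // w _; exists (pickle (Y w)).
rewrite -FT ge0_integral_bigcup//; first last.
- by move=> m n _ _ [w [<- <-]].
- by rewrite FT; exact: (@measurable_fun_countable _ _ f).
rewrite nneseries_esumT => [|n]; last by apply: integral_ge0 => w _.
rewrite (@esum_supported_image _ _ [set: T] pickle); first last.
- by move=> n /Fnone ->; rewrite integral_set0.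
- by move=> n; exact: integral_ge0.
- by move=> x y _ _; exact: (pcan_inj pickleK).
apply: eq_esum => x _; rewrite Fpickle -integral_cst//; apply: eq_integral => w.
by rewrite inE /= => ->.
Qed.

End countable_valued.

(** * Finite trajectories and the iterates of [K] *)

Section paths.
Variables (R : realType) (E : countType) (d : measure_display).
Variables (Omega : measurableType d) (Pr : E -> probability Omega R).
Variables (X : nat -> Omega -> E) (P : E -> E -> R) (B : set E).
Hypothesis P0 : forall i j, 0 <= P i j.
Hypothesis chainX : forall i, markov_chain (Pr i) X (fun j => (j == i)%:R) P.
Local Open Scope ereal_scope.

Fixpoint path_weight (i : E) (s : seq E) : R :=
  if s is x :: s' then (P i x * path_weight x s')%R else 1%R.

(** The head is the state at time 0 and is not tested, since [T(A)] only counts times from 1 on. The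
    value at the empty sequence is a dummy: a trajectory up to time [t] has [t.+1] states. *)
Definition path_eval (f : E -> \bar R) (s : seq E) : \bar R :=
  if s is x :: s' then if all (mem B) s' then f (last x s') else 0 else 0.

Let trajectory t w : seq E := mkseq (X ^~ w) t.+1.

Lemma path_weight_ge0 i s : (0 <= path_weight i s)%R.
Proof. by elim: s i => //= x s ih i; rewrite mulr_ge0. Qed.

Lemma path_weightE x s :
  path_weight x s = (\prod_(k < size s) P (nth x (x :: s) k) (nth x (x :: s) k.+1))%R.
Proof.
elim: s x => [|y s ih] x /=; first by rewrite big_ord0.
rewrite big_ord_recl /= ih; congr (_ * _)%R; apply: eq_bigr => k _ /=.
have ks := ltn_ord k; congr P.
  by rewrite (set_nth_default x)//= ltnS ltnW.
by rewrite (set_nth_default x).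
Qed.

Lemma trajectoryP t w x0 s : size s = t.+1 ->
  trajectory t w = s <-> (forall k, (k <= t)%N -> X k w = nth x0 s k).
Proof.
move=> st; split => [<- k kt|Xs]; first by rewrite nth_mkseq.
apply: (@eq_from_nth _ x0) => [|k]; first by rewrite size_mkseq.
by rewrite size_mkseq => kt; rewrite nth_mkseq// Xs.
Qed.

Lemma measurable_fiber t x : measurable (X t @^-1` [set x]).
Proof. by have [/(_ t x)] := chainX x. Qed.

Lemma measurable_trajectory t s : measurable (trajectory t @^-1` [set s]).
Proof.
have [st|st] := eqVneq (size s) t.+1; last first.
  rewrite (_ : _ @^-1` _ = set0)//; apply/seteqP; split => // w /= sw.
  by move: st; rewrite -sw size_mkseq eqxx.
case: s st => // x s st.
rewrite (_ : _ @^-1` _ = \bigcap_(k in [set k | (k <= t)%N]) X k @^-1` [set nth x (x :: s) k]).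
  by apply: bigcap_measurable => [|k _]; [exists 0%N|exact: measurable_fiber].
apply/seteqP; split => w; first by move/(trajectoryP _ x st) => Xs k /= /Xs.
by move=> Xs; apply/(trajectoryP _ x st) => k /Xs.
Qed.

Lemma Pr_trajectory t i s : size s = t ->
  Pr i (trajectory t @^-1` [set i :: s]) = (path_weight i s)%:E.
Proof.
move=> st; have [_ cX] := chainX i.
have := cX t (nth i (i :: s)); rewrite eqxx mul1r path_weightE st => <-.
congr (Pr i _); apply/seteqP; split => w; by move/(@trajectoryP _ _ i); apply; rewrite /= st.
Qed.

(** A wrong length gives an empty event; a wrong starting state gives a zero factor from the initial
    law. *)
Lemma Pr_trajectory0 t i s : ~ ([set i :: s | s in [set s | size s = t]] s) ->
  Pr i (trajectory t @^-1` [set s]) = 0.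
Proof.
move=> nis; have [st|st] := eqVneq (size s) t.+1; last first.
  rewrite (_ : _ @^-1` _ = set0) ?measure0//; apply/seteqP; split => // w /= sw.
  by move: st; rewrite -sw size_mkseq eqxx.
case: s st nis => // x s [st] nis; have [_ cX] := chainX i.
have := cX t (nth i (x :: s)); rewrite (_ : (nth i (x :: s) 0 == i) = false) ?mul0r.
  move=> c0; apply: etrans c0; congr (Pr i _).
  by apply/seteqP; split => w /(@trajectoryP _ _ i); apply; rewrite /= st.
by apply/eqP => /= xi; apply: nis; exists s; rewrite ?xi.
Qed.

(** Induction on the first step [k]: if [k] lies outside [B] the path contributes 0; otherwise the
    factor [P i k] comes out and [k] becomes the untested head of the shorter path. *)
Lemma path_sum (f : E -> \bar R) t i : (forall j, 0 <= f j) ->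
  \esum_(s in [set s | size s = t]) (path_eval f (i :: s) * (path_weight i s)%:E) =
  iter t (taboo P B) f i.
Proof.
move=> f0.
have term0 j s : 0 <= path_eval f (j :: s) * (path_weight j s)%:E.
  by rewrite mule_ge0 ?lee_fin ?path_weight_ge0//=; case: ifP.
elim: t i => [|t ih] i /=.
  rewrite (_ : [set _ | _] = [set [::]]); last by apply/seteqP; split => [[]|_ ->].
  by rewrite esum_set1 /= mule1.
rewrite (@reindex_esum _ _ _ ([set: E] `*`` fun=> [set s | size s = t]) _ (fun p => p.1 :: p.2)).
  rewrite -(@esum_esum _ _ _ _ _ (fun k s => path_eval f (i :: k :: s) *
    (path_weight i (k :: s))%:E)) => [|k s _ _]; last exact: term0.
  rewrite /taboo [RHS]esum_mkcond; apply: eq_esum => k _; case: ifPn => Bk; last first.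
    by apply: esum1 => s _; rewrite /= (negbTE Bk) mul0e.
  rewrite -ih -esumZl ?lee_fin//; apply: eq_esum => s _ /=.
  by rewrite Bk /= EFinM muleCA.
split => [[k s] [_ /= ->]//|[k s] [k' s'] _ _ [-> ->]//|[//|k s] [st]].
by exists (k, s).
Qed.

Lemma integral_taboo (f : E -> \bar R) t i : (forall j, 0 <= f j) ->
  \int[Pr i]_w path_eval f (trajectory t w) = iter t (taboo P B) f i.
Proof.
move=> f0.
have pf0 s : 0 <= path_eval f s by case: s => //= x s; case: ifP.
rewrite integral_countable//; last exact: measurable_trajectory.
rewrite -path_sum// (@esum_supported_image _ _ _ [set s | size s = t] (cons i)).
- by apply: eq_esum => s st; congr (_ * _); exact: Pr_trajectory.
- by move=> s s' _ _ [].
- by move=> s; rewrite mule_ge0.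
- by move=> s ns; rewrite [X in _ * X](Pr_trajectory0 ns) mule0.
Qed.

Lemma measurable_path_eval (f : E -> \bar R) t :
  measurable_fun setT (fun w => path_eval f (trajectory t w)).
Proof.
exact: (@measurable_fun_countable _ _ _ _ (trajectory t) (path_eval f)
  (measurable_trajectory t)).
Qed.

Lemma path_eval_trajectory (f : E -> \bar R) t w :
  path_eval f (trajectory t w) =
  if `[< forall s, (0 < s <= t)%N -> B (X s w) >] then f (X t w) else 0.
Proof.
rewrite /trajectory /mkseq /path_eval /=.
have -> : last (X 0 w) [seq X k w | k <- iota 1 t] = X t w.
  rewrite (last_nth (X 0 w)) size_map size_iota.
  by rewrite -[_ :: _]/(mkseq (X ^~ w) t.+1) nth_mkseq.
congr (if _ then _ else _); apply/idP/asboolP => [/allP BX s /andP[s0 st]|BX].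
  by apply/set_mem/BX/map_f; rewrite mem_iota s0 add1n ltnS.
apply/allP => _ /mapP[s + ->]; rewrite mem_iota add1n ltnS => /BX.
exact: mem_set.
Qed.

End paths.

(** * Measurability of pointwise limits in the extended reals *)

Section measurable_limit.
Variables (R : realType) (d : measure_display) (T : measurableType d).
Local Open Scope ereal_scope.

Lemma limn_esup_einf_cvg (u : (\bar R)^nat) :
  limn_esup u = limn_einf u -> u @ \oo --> limn_esup u.
Proof.
move=> su; apply: (@squeeze_cvge _ _ _ _ (einfs u) _ (esups u)).
- apply: nearW => n; apply/andP; split.
    by apply: ereal_inf_lbound; exists n => /=.
  by apply: ereal_sup_ubound; exists n => /=.
- by rewrite su limn_einf_lim; exact: is_cvg_einfs.
- by rewrite limn_esup_lim; exact: is_cvg_esups.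
Qed.

(* Where the sequence diverges, [limn] takes the constant value [point]. *)
Lemma measurable_fun_limn (u : nat -> T -> \bar R) :
  (forall n, measurable_fun setT (u n)) ->
  measurable_fun setT (fun w => limn (u ^~ w)).
Proof.
move=> mu.
have msup : measurable_fun setT (fun w => limn_esup (u ^~ w)).
  exact: measurable_fun_limn_esup.
have minf : measurable_fun setT (fun w => limn_einf (u ^~ w)).
  apply: measurableT_comp => //.
  by apply: measurable_fun_limn_esup => n; exact: measurableT_comp.
rewrite (_ : (fun w => _) = fun w => if limn_esup (u ^~ w) == limn_einf (u ^~ w)
    then limn_esup (u ^~ w) else point).
  by apply: measurable_fun_ifT => //; exact: measurable_fun_eqe.
apply/funext => w; case: eqP => [su|nsu].
  by apply/cvg_lim => //; exact: limn_esup_einf_cvg.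
apply: dvgP => cu; apply: nsu.
by rewrite is_cvg_limn_esupE// is_cvg_limn_einfE.
Qed.

End measurable_limit.

(** * Excursion sums and their expectations *)

Section excursions.
Variables (R : realType) (E : countType) (d : measure_display).
Variables (Omega : measurableType d) (Pr : E -> probability Omega R).
Variables (X : nat -> Omega -> E) (P : E -> E -> R) (A B : set E).
Hypothesis P0 : forall i j, 0 <= P i j.
Hypothesis chainX : forall i, markov_chain (Pr i) X (fun j => (j == i)%:R) P.
Hypothesis BA : B = ~` A.
Local Open Scope ereal_scope.

Let term (f : E -> \bar R) t w := path_eval B f (mkseq (X ^~ w) t.+1).

Definition excursion_sum (f : E -> \bar R) w : \bar R := \sum_(0 <= t <oo) term f t w.

Lemma lt_hit_time t w : (t%:R%:E < hit_time R X A w) =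
  `[< forall s, (0 < s <= t)%N -> B (X s w) >].
Proof.
apply/idP/asboolP => [tT s /andP[s0 st]|Bt].
  rewrite BA => As; move: tT; rewrite ltNge => /negP; apply.
  apply: (@le_trans _ _ s%:R%:E); last by rewrite lee_fin ler_nat.
  by apply: ereal_inf_lbound; exists s.
(* Bounding the infimum below by [t.+1] keeps the inequality strict, and also covers the case of no
   visit at all. *)
apply: (@lt_le_trans _ _ t.+1%:R%:E); first by rewrite lte_fin ltr_nat.
apply: le_ereal_inf_tmp => _ [s [s0 As] <-]; rewrite lee_fin ler_nat ltnNge.
by apply/negP => st; have := Bt s; rewrite s0 st BA => /(_ isT).
Qed.

Lemma termE f t w : term f t w =
  if t%:R%:E < hit_time R X A w then f (X t w) else 0.
Proof. by rewrite lt_hit_time /term path_eval_trajectory. Qed.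

Lemma exc_sumE g w : exc_sum X g A w = excursion_sum (EFin \o g) w.
Proof.
by apply: eq_eseriesr => t _; rewrite termE; case: ifP.
Qed.

(** The series counts the [t] with [t < T(A)]. If [A] is hit, the terms from the first hit on
    vanish; if not, the sum exceeds every integer. *)
Lemma hit_timeE w : hit_time R X A w = excursion_sum (cst 1) w.
Proof.
have t0 t : 0 <= term (cst 1) t w by rewrite termE; case: ifP.
have sum_lt n : (forall t, (t < n)%N -> t%:R%:E < hit_time R X A w) ->
    excursion_sum (cst 1) w = n%:R%:E + \sum_(n <= t <oo) term (cst 1) t w.
  move=> nT; rewrite /excursion_sum (@nneseries_split _ _ 0 n)// add0n.
  congr (_ + _); rewrite big_mkord (eq_bigr (fun=> 1)).
    by rewrite sumEFin sumr_const card_ord.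
  by move=> t _; rewrite termE nT.
have [exA|nA] := pselect (exists n, (0 < n)%N && `[< A (X n w) >]); last first.
  have Ty : hit_time R X A w = +oo.
    apply/ereal_inf_pinfty => _ [n [n0 An] <-]; exfalso; apply: nA.
    by exists n; rewrite n0; exact/asboolP.
  rewrite Ty; apply/esym/eqyP => x x0; have /ltW := archi_boundP (ltW x0).
  move: (Num.Def.archi_bound x) => n xn.
  apply: (@le_trans _ _ n%:R%:E); first by rewrite lee_fin.
  rewrite (sum_lt n) => [|t _]; last by rewrite Ty ltry.
  by rewrite leeDl// nneseries_ge0.
have [n /andP[n0 /asboolP An] nmin] := ex_minnP exA.
have Tn : hit_time R X A w = n%:R%:E.
  apply/eqP; rewrite eq_le; apply/andP; split.
    by apply: ereal_inf_lbound; exists n.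
  apply: le_ereal_inf_tmp => _ [s [s0 As] <-]; rewrite lee_fin ler_nat.
  by apply: nmin; rewrite s0; exact/asboolP.
rewrite (sum_lt n) => [|t tn]; last by rewrite Tn lte_fin ltr_nat.
rewrite eseries0 ?adde0// => t nt _.
by rewrite termE Tn lte_fin ltr_nat ltnNge nt.
Qed.

Lemma measurable_term f t : measurable_fun setT (term f t).
Proof. exact: measurable_path_eval chainX f t. Qed.

(** Since [f] may change sign, the series may diverge at some [w]; [measurable_fun_limn] allows for
    that. *)
Lemma measurable_excursion_sum f : measurable_fun setT (excursion_sum f).
Proof.
by apply: measurable_fun_limn => n; apply: emeasurable_sum => t; exact: measurable_term.
Qed.

Lemma term_ge0 f t w : (forall j, 0 <= f j) -> 0 <= term f t w.
Proof. by move=> f0; rewrite termE; case: ifP. Qed.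

Lemma excursion_sum_ge0 f w : (forall j, 0 <= f j) -> 0 <= excursion_sum f w.
Proof. by move=> f0; apply: nneseries_ge0 => t _ _; exact: term_ge0. Qed.

Lemma integral_excursion_sum f i : (forall j, 0 <= f j) ->
  \int[Pr i]_w excursion_sum f w = potential P B f i.
Proof.
move=> f0; rewrite integral_nneseries//; first last.
- by move=> t w _; exact: term_ge0.
- exact: measurable_term.
rewrite nneseries_esumT => [|t]; last by apply: integral_ge0 => w _; exact: term_ge0.
by apply: eq_esum => t _; exact: integral_taboo.
Qed.

Lemma tauAE i : tauA Pr X A i = fine (potential P B (cst 1) i).
Proof.
rewrite /tauA -integral_excursion_sum//; congr fine.
by apply: eq_integral => w _; rewrite hit_timeE.
Qed.

Lemma integrable_excursion_sum f i : (forall j, 0 <= f j) ->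
  potential P B f i < +oo -> (Pr i).-integrable setT (excursion_sum f).
Proof.
move=> f0 fin; apply/integrableP; split; first exact: measurable_excursion_sum.
under eq_integral => w _ do rewrite gee0_abs ?excursion_sum_ge0//.
by rewrite integral_excursion_sum.
Qed.

(** Finiteness of both parts at this [w] makes the series absolutely summable, hence equal to the
    difference of its parts. *)
Lemma excursion_sum_posneg (g : E -> R) w :
  let p := excursion_sum (fun j => (Num.max (g j) 0)%:E) w in
  let q := excursion_sum (fun j => (Num.max (- g j) 0)%:E) w in
  p \is a fin_num -> q \is a fin_num ->
  excursion_sum (EFin \o g) w = p - q.
Proof.
move=> p q pfin qfin.
have pos0 (x : R) : 0 <= (Num.max x 0)%:E by rewrite lee_fin le_max lexx orbT.
have posE : (fun t => term (EFin \o g) t w)^\+ =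
    (fun t => term (fun j => (Num.max (g j) 0)%:E) t w).
  by apply/funext => t; rewrite funeposE !termE; case: ifP => _; rewrite ?maxxx// -EFin_max.
have negE : (fun t => term (EFin \o g) t w)^\- =
    (fun t => term (fun j => (Num.max (- g j) 0)%:E) t w).
  apply/funext => t; rewrite funenegE !termE.
  by case: ifP => _; rewrite ?oppe0 ?maxxx//= -EFin_max.
rewrite /excursion_sum summable_eseries ?posE ?negE//.
rewrite /summable [X in esum X _](_ : _ = setT); last by apply/seteqP; split.
rewrite (eq_esum (b := fun t => term (fun j => (Num.max (g j) 0)%:E) t w +
                           term (fun j => (Num.max (- g j) 0)%:E) t w)); last first.
  by move=> t _; rewrite -[LHS]/((abse \o (fun t => term (EFin \o g) t w)) t) fune_abse posE negE.
rewrite esumD; try by move=> t _; exact: term_ge0.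
rewrite -!nneseries_esumT; try by move=> t; exact: term_ge0.
by rewrite lte_add_pinfty// ltey_eq ?pfin ?qfin.
Qed.

(** The two excursion sums have finite expectation, so both are finite almost everywhere. There
    [excursion_sum_posneg] applies, and the null set where it may fail does not affect the
    integral. *)
Lemma yAE (g : E -> R) i :
  let p := potential P B (fun j => (Num.max (g j) 0)%:E) i in
  let q := potential P B (fun j => (Num.max (- g j) 0)%:E) i in
  p < +oo -> q < +oo -> yA Pr X g A i = (fine p - fine q)%R.
Proof.
move=> p q pfin qfin.
have pos0 (x : R) : 0 <= (Num.max x 0)%:E by rewrite lee_fin le_max lexx orbT.
set fp := (fun j => (Num.max (g j) 0)%:E).
set fn := (fun j => (Num.max (- g j) 0)%:E).
have ip : (Pr i).-integrable setT (excursion_sum fp).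
  by apply: integrable_excursion_sum => // j; exact: pos0.
have iq : (Pr i).-integrable setT (excursion_sum fn).
  by apply: integrable_excursion_sum => // j; exact: pos0.
rewrite /yA -fineB; try by rewrite ge0_fin_numE//; apply: potential_ge0 => // j; exact: pos0.
rewrite /p /q -!integral_excursion_sum; try by move=> j; exact: pos0.
rewrite -integralB//; congr fine.
apply: ae_eq_integral => //.
- by rewrite (funext (exc_sumE g)); exact: measurable_excursion_sum.
- by apply: emeasurable_funB; exact: measurable_excursion_sum.
- have := integrable_ae measurableT ip; have := integrable_ae measurableT iq.
  apply: filterS2 => w qw pw _; rewrite exc_sumE.
  by apply: excursion_sum_posneg; [exact: pw|exact: qw].
Qed.

End excursions.

(** * Consequences of irreducibility *)

Section irreducibility.
Variables (R : realType) (E : countType) (d : measure_display).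
Variables (Omega : measurableType d) (Pr : E -> probability Omega R).
Variables (X : nat -> Omega -> E) (P : E -> E -> R).
Hypothesis P0 : forall i j, 0 <= P i j.
Hypothesis chainX : forall i, markov_chain (Pr i) X (fun j => (j == i)%:R) P.
Hypothesis irrX : irreducible Pr X.
Local Open Scope ereal_scope.

(** Were [j] outside [S], the chain started in [S] would be at [j] with probability 0 at each time,
    hence at some time with probability 0, against irreducibility. *)
Lemma irreducible_closed (S : set E) : S !=set0 ->
  (forall i j, S i -> (0 < P i j)%R -> S j) -> forall j, S j.
Proof.
move=> [i Si] clS j; apply: contrapT => nSj.
(* With [setT] in place of [B] no state is forbidden, so [iter t] applied to this indicator is the
   column [j] of [P^t]. *)
pose f k : \bar R := (k == j)%:R%:E.
have f0 k : 0 <= f k by rewrite lee_fin.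
have Kf0 t : forall k, S k -> iter t (taboo P setT) f k = 0.
  elim: t => [|t ih] k Sk /=.
    by rewrite /f (_ : k == j = false)//; apply/eqP => kj; apply: nSj; rewrite -kj.
  apply: esum1 => l _; have [Pkl|Pkl] := ltP 0%R (P k l).
    by rewrite ih ?mule0//; exact: clS Pkl.
  by rewrite (_ : P k l = 0%R) ?mul0e//; apply/eqP; rewrite eq_le Pkl P0.
have mX t : measurable (X t @^-1` [set j]) by exact: measurable_fiber chainX t j.
have Xj0 t : Pr i (X t @^-1` [set j]) = 0.
  rewrite -(Kf0 t i Si) -(integral_taboo setT P0 chainX _ _ f0).
  rewrite -[X in Pr i X]setIT -integral_indic//.
  apply: eq_integral => w _; rewrite path_eval_trajectory ifT; last exact/asboolP.
  rewrite /f indicE (_ : (w \in _) = (X t w == j))//.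
  by apply/idP/eqP => [/set_mem//|Xj]; exact/mem_set.
have := irrX i j; rewrite (_ : [set w | _] = \bigcup_n (X n @^-1` [set j])).
  have -> : Pr i (\bigcup_n (X n @^-1` [set j])) = 0; last by rewrite ltxx.
  apply: measure_negligible; first exact: bigcupT_measurable.
  by apply: negligible_bigcup => n; apply/negligibleP => //; exact: Xj0.
by apply/seteqP; split => w [n]; [exists n|move=> _; exists n].
Qed.

Variables (pi : E -> R) (A B : set E).
Hypothesis invpi : invariant_distribution pi P.
Hypothesis AB0 : A `&` B = set0.
Hypothesis ABT : A `|` B = [set: E].
Hypothesis A0 : A !=set0.

(** The support of [pi] is nonempty, because the total mass is 1, and closed under transitions,
    because [pi j >= pi i * P i j]. *)
Lemma invariant_gt0 i : (0 < pi i)%R.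
Proof.
have [pi0 pi1 piP] := invpi.
apply: (@irreducible_closed [set i | (0 < pi i)%R]).
  apply: contrapT => none; have : \esum_(i in [set: E]) (pi i)%:E = 0.
    apply: esum1 => j _; congr EFin; apply/eqP; rewrite eq_le pi0 andbT leNgt.
    by apply/negP => pij; apply: none; exists j.
  by rewrite pi1 => /eqP; rewrite onee_eq0.
move=> {}i j /= pii Pij; rewrite -lte_fin -piP.
apply: (@lt_le_trans _ _ (pi i * P i j)%:E); first by rewrite lte_fin mulr_gt0.
apply: (@esum_term_le _ _ _ (fun i => (pi i * P i j)%:E)) => // k _.
by rewrite lee_fin mulr_ge0.
Qed.

(** On [A], divide the bound of [invariant_potential] by [pi i > 0]. The set of finiteness is then
    closed under transitions: an arrival in [A] is already settled, and an arrival in [B] is bounded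
    through [potentialE]. *)
Lemma potential_lty (f : E -> \bar R) : (forall j, 0 <= f j) ->
  \esum_(i in [set: E]) ((pi i)%:E * f i) < +oo ->
  forall i, potential P B f i < +oo.
Proof.
move=> f0 pif.
have G0 i : 0 <= potential P B f i by exact: potential_ge0.
have pi0 i : 0 <= (pi i)%:E by rewrite lee_fin ltW// invariant_gt0.
have mul_lty (c : R) (x : \bar R) : (0 < c)%R -> c%:E * x < +oo -> x < +oo.
  by move=> c0; case: x => [x _|/=|//]; [rewrite ltry|rewrite gt0_muley ?lte_fin].
have finA i : A i -> potential P B f i < +oo.
  move=> Ai; apply: (mul_lty _ _ (invariant_gt0 i)).
  apply: le_lt_trans pif; apply: le_trans (invariant_potential P0 invpi AB0 ABT f0).
  by apply: (@esum_term_le _ _ _ (fun i => (pi i)%:E * potential P B f i)) => // k _;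
    rewrite mule_ge0.
apply: irreducible_closed.
  by have [a Aa] := A0; exists a; exact: finA.
move=> i j /= fini Pij; have [/finA//|Bj] : (A `|` B) j by rewrite ABT.
apply: (mul_lty _ _ Pij); apply: le_lt_trans fini.
rewrite [leRHS]potentialE//; apply: (@le_trans _ _ (taboo P B (potential P B f) i)).
  apply: (@esum_term_le _ _ _ (fun j => (P i j)%:E * potential P B f j)) => // k _.
  by rewrite mule_ge0 ?lee_fin.
by rewrite leeDr.
Qed.

End irreducibility.

(** * Poisson's equation, by splitting [h] into two finite potentials *)

Theorem theorem2p5 (R : realType) (E : countType) (d : measure_display)
    (Omega : measurableType d) (Pr : E -> probability Omega R)
    (X : nat -> Omega -> E) (P : E -> E -> R) (pi g : E -> R)
    (A B : set E) (h : E -> R) :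
  stochastic P ->
  (forall i, markov_chain (Pr i) X (fun j => (j == i)%:R) P) ->
  irreducible Pr X ->
  positive_recurrent Pr X ->
  invariant_distribution pi P ->
  (\esum_(i in [set: E]) (pi i * `|g i|)%:E < +oo)%E ->
  A `&` B = set0 -> A `|` B = [set: E] -> A !=set0 -> B !=set0 ->
  (* h_A, h_B as in the statement (the infinite sums being absolutely convergent) *)
  (forall i, A i -> (\esum_(j in A) (Qmat P B i j * (`|h j|)%:E) < +oo)%E) ->
  (forall k, B k -> (\esum_(j in A) (NBPBA P B k j * (`|h j|)%:E) < +oo)%E) ->
  (forall i, A i ->
     h i = yA Pr X g A i - rsum [set: E] (fun x => pi x * g x) * tauA Pr X A i
           + rsum A (fun j => fine (Qmat P B i j) * h j)) ->
  (forall k, B k ->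
     h k = yA Pr X g A k - rsum [set: E] (fun x => pi x * g x) * tauA Pr X A k
           + rsum A (fun j => fine (NBPBA P B k j) * h j)) ->
  (* Poisson's equation (I - P) h = g - omega 1, omega = pi g *)
  forall i,
    (\esum_(j in [set: E]) (P i j * `|h j|)%:E < +oo)%E /\
    h i - rsum [set: E] (fun j => P i j * h j)
      = g i - rsum [set: E] (fun x => pi x * g x).
Proof.
move=> [P0 _] chainX irrX _ invpi pig AB0 ABT A0 _ QhA QhB hA hB.
have BA : B = ~` A.
  apply/seteqP; split => x; first by move=> Bx Ax; rewrite -[False]/(set0 x) -AB0.
  by move=> nA; have [] : (A `|` B) x by rewrite ABT.
set w := rsum _ _ in hA hB *.
pose pos (x : R) := Num.max x 0.
have pos0 x : 0 <= pos x by rewrite le_max lexx orbT.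
have posE0 x : (0 <= (pos x)%:E)%E by rewrite lee_fin.
have pos_le x : pos x <= `|x| by rewrite ge_max ler_norm normr_ge0.
have posB x : pos x - pos (- x) = x.
  rewrite /pos; have [x0|/ltW x0] := leP 0 x.
    by rewrite max_r ?subr0// oppr_le0.
  by rewrite max_l ?oppr_ge0// sub0r opprK.
have pi0 j : 0 <= pi j by have [] := invpi.
have fin_one i : (potential P B (cst 1) i < +oo)%E.
  apply: (potential_lty P0 chainX irrX invpi AB0 ABT A0) => //.
  have [_ pi1 _] := invpi.
  by under eq_esum do rewrite mule1; rewrite pi1 ltry.
have fin_g (f : E -> R) i : (forall j, 0 <= f j <= `|g j|) ->
    (potential P B (EFin \o f) i < +oo)%E.
  move=> fg; apply: (potential_lty P0 chainX irrX invpi AB0 ABT A0) => [j|].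
    by rewrite lee_fin; have /andP[] := fg j.
  apply: le_lt_trans pig; apply: le_esum => j _ /=.
  by rewrite -EFinM lee_fin ler_wpM2l//; have /andP[] := fg j.
(* Here finiteness comes from the assumed absolute convergence: the potential of [P_{.A} |h|] is the
   row sum of [Qmat] on [A] and of [NBPBA] on [B]. *)
have fin_h (f : E -> R) i : (forall j, 0 <= f j <= `|h j|) ->
    (potential P B (restrictP P A (EFin \o f)) i < +oo)%E.
  move=> fh; have f0 j : (0 <= (EFin \o f) j)%E by rewrite lee_fin; have /andP[] := fh j.
  apply: (@le_lt_trans _ _ (potential P B (restrictP P A (fun j => `|h j|%:E)) i)).
    apply: le_potential => // j; first exact: restrictP_ge0.
    apply: le_esum => k _; rewrite lee_wpmul2l ?lee_fin//.
    by have /andP[] := fh k.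
  have [Ai|Bi] : (A `|` B) i by rewrite ABT.
    by rewrite -Qmat_potential// QhA.
  by rewrite -NBPBA_potential// QhB.
(* One nonnegative half of [g - w + P_{.A} h_A]. The constant is kept as [c%:E * 1] so that
   [potentialZ] yields a multiple of the potential of [cst 1], which is [tau]. *)
pose part (gs hs : E -> R) (c : R) i : \bar R :=
  ((gs i)%:E + (c%:E * 1 + restrictP P A (EFin \o hs) i))%E.
have part_ge0 gs hs c : (forall j, 0 <= gs j) -> (forall j, 0 <= hs j) -> 0 <= c ->
    forall j, (0 <= part gs hs c j)%E.
  move=> gs0 hs0 c0 j; rewrite /part adde_ge0 ?lee_fin//.
  by rewrite adde_ge0 ?mule1 ?lee_fin//; apply: restrictP_ge0 => // k; rewrite lee_fin.
have part_potential gs hs c i : (forall j, 0 <= gs j) -> (forall j, 0 <= hs j) -> 0 <= c ->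
    potential P B (part gs hs c) i =
    (potential P B (EFin \o gs) i + (c%:E * potential P B (cst 1) i +
     potential P B (restrictP P A (EFin \o hs)) i))%E.
  move=> gs0 hs0 c0.
  have r0 j : (0 <= restrictP P A (EFin \o hs) j)%E.
    by apply: restrictP_ge0 => // k; rewrite lee_fin.
  rewrite potentialD//; first by rewrite potentialD// ?potentialZ// => j; rewrite mule1 lee_fin.
  by move=> j; rewrite adde_ge0 ?mule1 ?lee_fin.
(* Since [w] is subtracted, its negative part goes to [psi1] and its positive part to [psi2]. *)
pose psi1 := part (fun j => pos (g j)) (fun j => pos (h j)) (pos (- w)).
pose psi2 := part (fun j => pos (- g j)) (fun j => pos (- h j)) (pos w).
pose u := potential P B psi1.
pose v := potential P B psi2.
have psi1_ge0 j : (0 <= psi1 j)%E by exact: part_ge0.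
have psi2_ge0 j : (0 <= psi2 j)%E by exact: part_ge0.
have pot_g_ge0 (f : E -> R) i : (0 <= potential P B (EFin \o (fun j => pos (f j))) i)%E.
  by apply: potential_ge0 => // j; exact: posE0.
have pot_h_ge0 (f : E -> R) i :
    (0 <= potential P B (restrictP P A (EFin \o (fun j => pos (f j)))) i)%E.
  by apply: potential_ge0 => // j; apply: restrictP_ge0 => // k; exact: posE0.
have fin_g1 i : potential P B (EFin \o (fun j => pos (g j))) i \is a fin_num.
  by rewrite ge0_fin_numE//; apply: fin_g => j; rewrite pos0 pos_le.
have fin_g2 i : potential P B (EFin \o (fun j => pos (- g j))) i \is a fin_num.
  by rewrite ge0_fin_numE//; apply: fin_g => j; rewrite pos0 -normrN pos_le.
have fin_h1 i : potential P B (restrictP P A (EFin \o (fun j => pos (h j)))) i \is a fin_num.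
  by rewrite ge0_fin_numE//; apply: fin_h => j; rewrite pos0 pos_le.
have fin_h2 i : potential P B (restrictP P A (EFin \o (fun j => pos (- h j)))) i \is a fin_num.
  by rewrite ge0_fin_numE//; apply: fin_h => j; rewrite pos0 -normrN pos_le.
have fin_1 i : potential P B (cst 1%E) i \is a fin_num.
  by rewrite ge0_fin_numE//; exact: potential_ge0.
have fin_u i : u i \is a fin_num.
  by rewrite /u part_potential// !fin_numD fin_g1 fin_numM// fin_h1.
have fin_v i : v i \is a fin_num.
  by rewrite /v part_potential// !fin_numD fin_g2 fin_numM// fin_h2.
(* The formulas for [h_A] and [h_B] become one, because both matrix sums are potentials of [P_{.A}]
   applied to the parts of [h]. *)
have h_rsum i : h i = yA Pr X g A i - w * tauA Pr X A i +
    (fine (potential P B (restrictP P A (EFin \o (fun j => pos (h j)))) i) -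
     fine (potential P B (restrictP P A (EFin \o (fun j => pos (- h j)))) i)).
  have [Ai|Bi] : (A `|` B) i by rewrite ABT.
    rewrite [LHS]hA// rsum_fineM ?QhA// => [|j]; last exact: Qmat_ge0.
    by rewrite -!Qmat_potential// => k; exact: posE0.
  rewrite [LHS]hB// rsum_fineM ?QhB// => [|j]; last exact: NBPBA_ge0.
  by rewrite -!NBPBA_potential// => k; exact: posE0.
have h_uv i : h i = fine (u i) - fine (v i).
  rewrite h_rsum (yAE P0 chainX BA); first last.
  - by rewrite -ge0_fin_numE; [exact: fin_g2|exact: (pot_g_ge0 (fun j => - g j))].
  - by rewrite -ge0_fin_numE; [exact: fin_g1|exact: pot_g_ge0].
  rewrite (tauAE P0 chainX BA) /u /v !part_potential//.
  rewrite !fineD ?fin_numD ?fin_numM ?fin_g1 ?fin_g2 ?fin_h1 ?fin_h2 ?fin_1//.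
  rewrite !fineM// -{1}(posB w) /=; ring.
have u_ge0 i : 0 <= fine (u i) by rewrite fine_ge0// potential_ge0.
have v_ge0 i : 0 <= fine (v i) by rewrite fine_ge0// potential_ge0.
(* [p] and [q] mix two splittings of [h], by sign on [A] and by potentials on [B]. Then [P p] is
   [P_{.A} h^+ + K u], just what unfolding [u] once produces, and likewise for [q] and [v]. *)
pose p j := if j \in A then pos (h j) else fine (u j).
pose q j := if j \in A then pos (- h j) else fine (v j).
have p0 j : 0 <= p j by rewrite /p; case: ifP.
have q0 j : 0 <= q j by rewrite /q; case: ifP.
have hpq j : h j = p j - q j.
  by rewrite /p /q; case: ifP => _; [rewrite posB|exact: h_uv].
have step (hs : E -> R) (z : E -> \bar R) i : (forall j, 0 <= hs j) ->
    (forall j, z j \is a fin_num) -> (forall j, 0 <= fine (z j)) ->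
    (\esum_(j in [set: E]) (P i j * (if j \in A then hs j else fine (z j)))%:E =
    restrictP P A (EFin \o hs) i + taboo P B z i)%E.
  move=> hs0 finz z0; rewrite (esum_partition AB0 ABT); last first.
    by move=> j; rewrite lee_fin mulr_ge0//; case: ifP.
  congr (_ + _)%E; apply: eq_esum => j.
    by move=> Aj; rewrite mem_set// EFinM.
  move=> Bj; rewrite memNset; first by rewrite EFinM fineK.
  by move: Bj; rewrite BA.
move=> i.
(* This is [G = id + K G] at [psi1], with [step] collecting the [A] and [B] columns into a full row
   of [P]. *)
have uE : u i = ((pos (g i))%:E + ((pos (- w))%:E +
    \esum_(j in [set: E]) (P i j * p j)%:E))%E.
  rewrite (step (fun j => pos (h j)) u)// /u potentialE// /psi1 /part mule1.
  by rewrite !addeA.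
have vE : v i = ((pos (- g i))%:E + ((pos w)%:E +
    \esum_(j in [set: E]) (P i j * q j)%:E))%E.
  by rewrite (step (fun j => pos (- h j)) v)// /v potentialE// /psi2 /part mule1 !addeA.
(* A summand of the finite [u i] is finite; with the same for [q], [|h| <= p + q] gives the
   summability of [P |h|]. *)
have fin_p : \esum_(j in [set: E]) (P i j * p j)%:E \is a fin_num.
  by move: (fin_u i); rewrite uE !fin_numD => /and3P[].
have fin_q : \esum_(j in [set: E]) (P i j * q j)%:E \is a fin_num.
  by move: (fin_v i); rewrite vE !fin_numD => /and3P[].
have Pp0 j : 0 <= P i j * p j by rewrite mulr_ge0.
have Pq0 j : 0 <= P i j * q j by rewrite mulr_ge0.
split.
  apply: (@le_lt_trans _ _ (\esum_(j in [set: E]) ((P i j * p j)%:E + (P i j * q j)%:E)%E)).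
    apply: le_esum => j _; rewrite -EFinD lee_fin -mulrDr ler_wpM2l//.
    by rewrite hpq (le_trans (ler_normB _ _))// !ger0_norm.
  rewrite esumD; try by move=> j _; rewrite lee_fin.
  by rewrite lte_add_pinfty// -ge0_fin_numE//; apply: esum_ge0 => j _; rewrite lee_fin.
rewrite (@rsum_sub _ _ _ _ (fun j => P i j * p j) (fun j => P i j * q j))//; first last.
- by rewrite -ge0_fin_numE//; apply: esum_ge0 => j _; rewrite lee_fin.
- by rewrite -ge0_fin_numE//; apply: esum_ge0 => j _; rewrite lee_fin.
- by move=> j _; rewrite -mulrBr -hpq.
(* In [u i - v i] the sums [P p] and [P q] cancel against [P h], leaving the parts of [g i] and of
   [w], which recombine. *)
rewrite {1}h_uv uE vE !fineD ?fin_numD ?fin_p ?fin_q//=.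
rewrite -{3}(posB (g i)) -{3}(posB w); ring.
Qed.
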